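(* Let $\mathcal J_i$ be a finite nonempty index set, $\mathbb U\subseteq\mathbb R^d$, and let $a_{ij}\in\mathbb R^d\setminus\{0\}$, $b_{ij}\in\mathbb R$ for $j\in\mathcal J_i$. Let $\mathcal K_i\subseteq\mathcal J_i$ have $K$ elements, let $\tilde a_{i1},\dots,\tilde a_{iK}$ be the normals $a_{ij}$ with $j\in\mathcal K_i$, and let $b_1^{\mathrm{kept}},\dots,b_K^{\mathrm{kept}}$ be the corresponding offsets $b_{ij}$. Suppose there are $\lambda_{jk}\ge0$ with $a_{ij}=\sum_{k=1}^K\lambda_{jk}\tilde a_{ik}$ for every $j\in\mathcal J_i$. Let $v^{\mathrm{nom}}\in\mathbb R^d$, $s_k=\tilde a_{ik}^\top v^{\mathrm{nom}}$, $d_j=\sum_{k=1}^K\lambda_{jk}$, $$\epsilon^\star=\max\Big\{\max_{1\le k\le K}\big(b_k^{\mathrm{kept}}-s_k\big),\ \max_{j\in\mathcal J_i}\frac{b_{ij}-\sum_{k=1}^K\lambda_{jk}s_k}{d_j}\Big\},\qquad \tilde b_k=s_k+\epsilon^\star .$$ Define the full and reduced admissible sets $$\mathcal U_i=\{u\in\mathbb U: a_{ij}^\top u\ge b_{ij}\ \forall j\in\mathcal J_i\},\qquad \widetilde{\mathcal U}_i=\{u\in\mathbb U:\tilde a_{ik}^\top u\ge\tilde b_k,\ k=1,\dots,K\}.$$ If $v^{\mathrm{nom}}\in\mathcal U_i$, then $\epsilon^\star\le0$ and $v^{\mathrm{nom}}\in\widetilde{\mathcal U}_i$.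
   Context: In the application, $a_{ij}^\top u\ge b_{ij}$ are the (already tube-tightened) safety halfspaces of agent $i$ in its control space, and $v^{\mathrm{nom}}$ is a prescribed nominal control. Since $a_{ij}\ne0$, the conic representation forces $d_j>0$, so $\epsilon^\star$ is well defined. *)

(* Defs.v *)
From HB Require Import structures.
From mathcomp Require Import all_boot all_order all_algebra.
From mathcomp Require Import boolp classical_sets reals.

Set Implicit Arguments.
Unset Strict Implicit.
Unset Printing Implicit Defensive.

Import Order.TTheory GRing.Theory Num.Theory.
Local Open Scope classical_set_scope.
Local Open Scope ring_scope.

Definition dotv (R : realType) (d : nat) (x u : 'cV[R]_d) : R :=
  (x^T *m u) 0 0.

(* The maximum of a real family over a finite index type.  The value [0] on an
   empty index type is a junk value; [finmaxP] characterizes the other case. *)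
Definition finmax (R : realType) (T : finType) (F : T -> R) : R :=
  if [pick t : T] is Some t0 then \big[Num.max/F t0]_(t : T) F t else 0.

Lemma finmaxP (R : realType) (T : finType) (F : T -> R) :
  (0 < #|T|)%N ->
  (exists t, finmax F = F t) /\ (forall t, F t <= finmax F).
Proof.
rewrite /finmax; case: pickP => [t0 _ _|T0]; last first.
  by case/card_gt0P => t _; have := T0 t.
split; last by move=> t; apply: le_bigmax.
elim/big_ind: _ => [|x y [t ->] [u ->]|t _]; [by exists t0| |by exists t].
by case: (leP (F t) (F u)) => _; [exists u|exists t].
Qed.

Definition halfspaces (R : realType) (d : nat) (T : finType)
    (U : set 'cV[R]_d) (a : T -> 'cV[R]_d) (b : T -> R) : set 'cV[R]_d :=
  [set u | U u /\ forall t, b t <= dotv (a t) u].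

Section Reduction.
Variables (R : realType) (d : nat) (J : finType) (K : nat).
(* [kappa] enumerates the kept indices, so that the kept normals and offsets
   are [a \o kappa] and [b \o kappa]. *)
Variables (kappa : 'I_K -> J) (a : J -> 'cV[R]_d) (b : J -> R).
Variables (lam : J -> 'I_K -> R) (vnom : 'cV[R]_d).

Definition nominal_value (k : 'I_K) : R := dotv (a (kappa k)) vnom.

Definition lam_sum (j : J) : R := \sum_(k < K) lam j k.

(* If [a j = \sum_k lam j k *: a (kappa k)] with [a j != 0] and [lam >= 0], then
   [lam_sum j > 0] and [0 < K]: neither a division by zero nor an empty maximum
   occurs below as soon as [J] is nonempty. *)
Definition eps_star : R :=
  Num.max (finmax (fun k => b (kappa k) - nominal_value k))
          (finmax (fun j =>
             (b j - \sum_(k < K) lam j k * nominal_value k) / lam_sum j)).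

Definition reduced_offset (k : 'I_K) : R := nominal_value k + eps_star.

Definition full_admissible (U : set 'cV[R]_d) : set 'cV[R]_d :=
  halfspaces U a b.

Definition reduced_admissible (U : set 'cV[R]_d) : set 'cV[R]_d :=
  halfspaces U (a \o kappa) reduced_offset.

End Reduction.

(* Main.v *)
Require Import Defs.
From HB Require Import structures.
From mathcomp Require Import all_boot all_order all_algebra.
From mathcomp Require Import boolp classical_sets reals.

Set Implicit Arguments.
Unset Strict Implicit.
Unset Printing Implicit Defensive.

Import Order.TTheory GRing.Theory Num.Theory.
Local Open Scope classical_set_scope.
Local Open Scope ring_scope.

(** Every entry of the two maxima in [eps_star] is nonpositive when [vnom] is feasible. For a kept
    index this is its own constraint. For any [j], linearity ([dotv_conic]) turns the conic
    combination of nominal values into [dotv (a j) vnom], which is at least [b j]. Hence each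
    reduced offset is the value at [vnom] shifted by a nonpositive amount, so [vnom] meets it. *)

(** A nonempty maximum is attained, hence inherits the bound; on an empty type the default value 0
    meets it. *)
Lemma finmax_le0 (R : realType) (T : finType) (F : T -> R) :
  (forall t, F t <= 0) -> finmax F <= 0.
Proof.
move=> F_le0; case: (posnP #|T|) => [/card0_eq T0|/finmaxP-/(_ _ F)[[t ->] _] //].
by rewrite /finmax; case: pickP => // t _; have := T0 t.
Qed.

Lemma dotv_conic (R : realType) (d K : nat) (c : 'I_K -> R)
    (x : 'I_K -> 'cV[R]_d) (u : 'cV[R]_d) :
  dotv (\sum_(k < K) c k *: x k) u = \sum_(k < K) c k * dotv (x k) u.
Proof.
rewrite /dotv linear_sum mulmx_suml summxE; apply: eq_bigr => k _.
by rewrite linearZ -scalemxAl mxE.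
Qed.

Theorem mainTheorem2 (R : realType) (d : nat) (J : finType)
    (U : set 'cV[R]_d) (a : J -> 'cV[R]_d) (b : J -> R)
    (Kept : {set J}) (K : nat) (kappa : 'I_K -> J)
    (lam : J -> 'I_K -> R) (vnom : 'cV[R]_d)
    (J_nonempty : (0 < #|J|)%N)
    (a_neq0 : forall j, a j != 0)
    (card_Kept : #|Kept| = K)
    (kappa_inj : injective kappa)
    (kappa_Kept : codom kappa =i Kept)
    (lam_ge0 : forall j k, 0 <= lam j k)
    (a_conic : forall j, a j = \sum_(k < K) lam j k *: a (kappa k))
    (vnom_full : full_admissible a b U vnom) :
  eps_star kappa a b lam vnom <= 0 /\
  reduced_admissible kappa a b lam vnom U vnom.
Proof.
case: vnom_full => U_vnom b_le.
have eps_le0 : eps_star kappa a b lam vnom <= 0.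
  rewrite /eps_star ge_max; apply/andP; split; apply: finmax_le0; [move=> k|move=> j].
    by rewrite subr_le0; apply: b_le.
  (* The denominator is a sum of nonnegative weights, so the sign is decided by the numerator. *)
  apply: mulr_le0_ge0; last by rewrite invr_ge0; apply: sumr_ge0.
  by rewrite subr_le0 /nominal_value -dotv_conic -a_conic.
split=> //; split=> // k.
by rewrite /reduced_offset gerDl.
Qed.
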